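(* Let $G$ be a finite simple graph that is $(P_2\cup P_4)$-free and butterfly-free. Then $\chi(G)\le \frac{\omega(G)^2+3\omega(G)-2}{2}$.
   Context: $P_t$ denotes the path on $t$ vertices. For vertex-disjoint graphs $G_1,G_2$, $G_1\cup G_2$ is their disjoint union (no edges between them). A graph $G$ is $H$-free if no induced subgraph of $G$ is isomorphic to $H$. A butterfly is the graph consisting of two triangles sharing exactly one vertex. $\chi(G)$ is the chromatic number and $\omega(G)$ the clique number of $G$. *)

(* Defs.v *)
From HB Require Import structures.
From mathcomp Require Import all_boot all_order all_algebra.

Set Implicit Arguments.
Unset Strict Implicit.
Unset Printing Implicit Defensive.

Record sgraph := SGraph {
  vertex :> finType;
  edge : rel vertex;
  edge_sym : symmetric edge;
  edge_irrefl : irreflexive edge }.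

Definition isomorphic (G H : sgraph) : Prop :=
  exists f : G -> H, bijective f /\ forall x y, edge (f x) (f y) = edge x y.

Section Induced.
Variables (G : sgraph) (S : {set G}).

Definition induced_edge : rel {x : G | x \in S} :=
  fun x y => edge (val x) (val y).

Lemma induced_edge_sym : symmetric induced_edge.
Proof. by move=> x y; apply: edge_sym. Qed.

Lemma induced_edge_irrefl : irreflexive induced_edge.
Proof. by move=> x; apply: edge_irrefl. Qed.

Definition induced : sgraph := SGraph induced_edge_sym induced_edge_irrefl.
End Induced.

Definition free_of (H G : sgraph) : Prop :=
  forall S : {set G}, ~ isomorphic (induced S) H.

Section Path.
Variable t : nat.

Definition path_edge : rel 'I_t :=
  fun i j => (i.+1 == j :> nat) || (j.+1 == i :> nat).

Lemma path_edge_sym : symmetric path_edge.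
Proof. by move=> i j; rewrite /path_edge orbC. Qed.

Lemma path_edge_irrefl : irreflexive path_edge.
Proof. by move=> i; rewrite /path_edge orbb -[X in _ == X]add0n -add1n eqn_add2r. Qed.

(* [t] counts vertices, not edges. *)
Definition path_graph : sgraph := SGraph path_edge_sym path_edge_irrefl.
End Path.

Section DisjointUnion.
Variables G1 G2 : sgraph.

Definition disjoint_union_edge : rel (G1 + G2)%type := fun u v =>
  match u, v with
  | inl x, inl y => edge x y
  | inr x, inr y => edge x y
  | _, _ => false
  end.

Lemma disjoint_union_edge_sym : symmetric disjoint_union_edge.
Proof. by case=> x [] y //=; apply: edge_sym. Qed.

Lemma disjoint_union_edge_irrefl : irreflexive disjoint_union_edge.
Proof. by case=> x /=; apply: edge_irrefl. Qed.

Definition disjoint_union : sgraph :=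
  SGraph disjoint_union_edge_sym disjoint_union_edge_irrefl.
End DisjointUnion.

(* The triangles are {0, 1, 2} and {0, 3, 4}. *)
Definition butterfly_edges : seq (nat * nat) :=
  [:: (0, 1); (0, 2); (1, 2); (0, 3); (0, 4); (3, 4)].

Definition butterfly_edge : rel 'I_5 := fun i j =>
  ((i : nat, j : nat) \in butterfly_edges)
  || ((j : nat, i : nat) \in butterfly_edges).

Lemma butterfly_edge_sym : symmetric butterfly_edge.
Proof. by move=> i j; rewrite /butterfly_edge orbC. Qed.

Lemma butterfly_edge_irrefl : irreflexive butterfly_edge.
Proof. by case=> [[|[|[|[|[|i]]]]] lti]. Qed.

Definition butterfly : sgraph :=
  SGraph butterfly_edge_sym butterfly_edge_irrefl.

Section Invariants.
Variable G : sgraph.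

Definition proper_coloring k (c : {ffun G -> 'I_k}) : bool :=
  [forall x, forall y, edge x y ==> (c x != c y)].

Definition colorable (k : nat) : bool :=
  [exists c : {ffun G -> 'I_k}, proper_coloring c].

Lemma colorable_exists : exists k, colorable k.
Proof.
exists #|G|; apply/existsP; exists [ffun x => enum_rank x].
apply/forallP=> x; apply/forallP=> y; apply/implyP=> xy; rewrite !ffunE.
by apply: contraTneq xy => /enum_rank_inj ->; rewrite edge_irrefl.
Qed.

Definition chromatic_number : nat := ex_minn colorable_exists.

Definition clique (K : {set G}) : bool :=
  [forall x in K, forall y in K, (x != y) ==> edge x y].

Definition clique_number : nat := \max_(K : {set G} | clique K) #|K|.
End Invariants.

(* Main.v *)
(** Wagner's argument. Fix a maximum clique [A] and let [non_neighbours v] be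
    the set of vertices of [A] not adjacent to [v]. A clique [K] has at least
    [#|K|] non-neighbours in [A] altogether, since otherwise exchanging them for
    [K] would enlarge [A]. Hence every [v] has a non-neighbour in [A], and the
    vertices whose only non-neighbour is [i] are independent.
    Now let [a] and [b] be distinct vertices of [A]. The vertices adjacent to
    neither induce a P4-free graph, as [ab] is a P2, and greedy colouring is
    optimal on P4-free graphs, so [omega] colours suffice there. Every remaining
    vertex [v] has two non-neighbours in [A] and is labelled by a pair [P] of
    them, chosen to contain [a] if possible. Vertices with label [P] are all
    adjacent to [b] if [P] contains [a], and to [a] otherwise, so an edge
    between two of them would form a butterfly with [P]. The label [{a, b}]
    does not occur, so the total is [omega + (binomial omega 2 - 1) + omega]. *)
Require Import Defs.
From mathcomp Require Import all_boot all_order all_algebra.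
From mathcomp Require Import zify.

Set Implicit Arguments.
Unset Strict Implicit.
Unset Printing Implicit Defensive.

Import GRing.Theory Num.Theory.

Section InducedEmbeddings.
Implicit Types G H : sgraph.

Definition induced_embedding H G (f : H -> G) :=
  injective f /\ {mono f : x y / edge x y}.

Definition free_on H G (S : {set G}) := forall f : H -> G,
  induced_embedding f -> ~ forall x, f x \in S.

Lemma free_of_embedding H G (f : H -> G) :
  free_of H G -> ~ induced_embedding f.
Proof.
move=> Hfree [f_inj f_edge]; set S := f @: [set: H]; apply: (Hfree S).
have fS x : f x \in S by rewrite imset_f.
pose g x : induced S := exist (fun u => u \in S) (f x) (fS x).
have g_inj : injective g by move=> x y /(congr1 val)/f_inj.
have card_S : #|induced S| <= #|H|.
  by rewrite card_sig (eq_card (B := S)) // card_imset // cardsT.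
have [h gK hK] := inj_card_bij g_inj card_S.
exists h; split=> [|x y]; first by exists g.
by rewrite -f_edge -[in RHS](hK x) -[in RHS](hK y).
Qed.

Lemma free_of_disjoint_union H1 H2 G (f1 : H1 -> G) (S : {set G}) :
  free_of (disjoint_union H1 H2) G -> induced_embedding f1 ->
  (forall x, {in S, forall v, v != f1 x /\ ~~ edge (f1 x) v}) -> free_on H2 S.
Proof.
move=> Hfree [f1_inj f1_edge] S_far f2 [f2_inj f2_edge] f2S.
pose f (z : disjoint_union H1 H2) :=
  match z with inl x => f1 x | inr y => f2 y end.
apply: (@free_of_embedding _ _ f Hfree); split.
  move=> [x|x] [y|y] /= => [/f1_inj->|fxy|fxy|/f2_inj->] //.
    by have [] := S_far x _ (f2S y); rewrite fxy eqxx.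
  by have [] := S_far y _ (f2S x); rewrite fxy eqxx.
case=> [x|x] [y|y] //=.
  by have [_ /negPf] := S_far x _ (f2S y).
by have [_ /negPf] := S_far y _ (f2S x); rewrite edge_sym.
Qed.

Definition twin_free H := forall x y : H, edge x =1 edge y -> x = y.

Lemma twin_free_embedding H G (f : H -> G) :
  twin_free H -> {mono f : x y / edge x y} -> induced_embedding f.
Proof.
move=> Htwin f_edge; split=> // x y fxy.
by apply: Htwin => z; rewrite -!f_edge fxy.
Qed.

Lemma mono_edge_ltn n (e : rel 'I_n) (e_sym : symmetric e)
    (e_irrefl : irreflexive e) G (f : SGraph e_sym e_irrefl -> G) :
  (forall i j : 'I_n, i < j -> edge (f i) (f j) = e i j) ->
  {mono f : i j / edge i j}.
Proof.
move=> f_lt i j; case: (ltngtP i j) => [ij|ji|/val_inj ->]; first exact: f_lt.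
  by rewrite edge_sym f_lt //= e_sym.
by rewrite !edge_irrefl.
Qed.

Lemma twin_free_path t : t != 3 -> twin_free (path_graph t).
Proof.
move=> t3 i j; wlog ij : i j / i <= j => [twin eij|].
  by case/orP: (leq_total i j) => [/twin->|/twin->].
move=> eij; apply: val_inj => /=; move: (ltn_ord i) (ltn_ord j) => it jt.
have eij_nat k (kt : k < t) :
    (i.+1 == k) || (k.+1 == i) = (j.+1 == k) || (k.+1 == j).
  exact: (eij (Ordinal kt)).
have := eij_nat i.+1; have := eij_nat j.+1; have := eij_nat i.-1.
by lia.
Qed.

Lemma twin_free_butterfly : twin_free butterfly.
Proof.
case=> [[|[|[|[|[|i]]]]] ilt] // [[|[|[|[|[|j]]]]] jlt] // eij;
  apply: val_inj => //; move: (eij (inord 0)) (eij (inord 1)) (eij (inord 2));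
  move: (eij (inord 3)) (eij (inord 4)); by rewrite /= /butterfly_edge !inordK.
Qed.

End InducedEmbeddings.

Section ForbiddenSubgraphs.
Variable G : sgraph.

Definition neighbours (v : G) : {set G} := [set u | edge v u].

Lemma P4_free_chord (S : {set G}) p q r s : free_on (path_graph 4) S ->
  {subset [:: p; q; r; s] <= S} -> edge p q -> edge q r -> edge r s ->
  [|| edge p r, edge q s | edge p s].
Proof.
move=> SP4 pqrsS pq qr rs; apply/contraT; rewrite !negb_or.
case/and3P=> /negPf pr /negPf qs /negPf ps.
pose f (i : path_graph 4) := nth p [:: p; q; r; s] (i : 'I_4).
have [] := SP4 f; last by move=> i; rewrite pqrsS // mem_nth.
apply: twin_free_embedding; first exact: twin_free_path.
by apply: mono_edge_ltn => [[[|[|[|[|i]]]] ?] [[|[|[|[|j]]]] ?]].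
Qed.

Lemma butterfly_free_neighbours o u v x y : free_of butterfly G ->
  {subset [:: u; v; x; y] <= neighbours o} -> edge u v -> edge x y ->
  [|| edge u x, edge u y, edge v x | edge v y].
Proof.
move=> bf uvxyN uv xy; apply/contraT; rewrite !negb_or.
case/and4P=> /negPf ux /negPf uy /negPf vx /negPf vy.
have o_edge w : w \in [:: u; v; x; y] -> edge o w by move/uvxyN; rewrite inE.
pose f (i : butterfly) := nth o [:: o; u; v; x; y] (i : 'I_5).
case: (@free_of_embedding _ _ f bf).
apply: twin_free_embedding; first exact: twin_free_butterfly.
apply: mono_edge_ltn => [[[|[|[|[|[|i]]]]] ?] [[|[|[|[|[|j]]]]] ?]] //= _;
  by rewrite o_edge // !inE eqxx ?orbT.
Qed.

Lemma P2UP4_free_anticomplete a b :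
  free_of (disjoint_union (path_graph 2) (path_graph 4)) G -> edge a b ->
  free_on (path_graph 4) (~: (neighbours a :|: neighbours b)).
Proof.
move=> pf ab; pose f (i : path_graph 2) := nth a [:: a; b] (i : 'I_2).
apply: (free_of_disjoint_union (f1 := f) pf).
  apply: twin_free_embedding; first exact: twin_free_path.
  by apply: mono_edge_ltn => [[[|[|i]] ?] [[|[|j]] ?]].
case=> [[|[|i]] ?] // v; rewrite !inE negb_or /= => /andP[av bv]; split=> //.
  by apply: contraNneq bv => ->; rewrite edge_sym.
by apply: contraNneq av => ->.
Qed.

End ForbiddenSubgraphs.

Section Cliques.
Variable G : sgraph.
Implicit Types (K : {set G}) (x : G).

Lemma cliqueP K :
  reflect {in K &, forall x y, x != y -> edge x y} (clique K).
Proof.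
apply: (iffP forall_inP) => [KP x y Kx Ky | KP x Kx].
  exact/implyP/(forall_inP (KP x Kx)).
by apply/forall_inP => y Ky; apply/implyP/KP.
Qed.

Lemma clique1 x : clique [set x].
Proof. by apply/cliqueP => u v /set1P-> /set1P->; rewrite eqxx. Qed.

Lemma cliqueS K1 K2 : K1 \subset K2 -> clique K2 -> clique K1.
Proof.
by move=> /subsetP sK /cliqueP K2P; apply/cliqueP; apply: sub_in2 K2P.
Qed.

Lemma cliqueU K1 K2 :
  clique K1 -> clique K2 -> {in K1 & K2, forall x y, edge x y} ->
  clique (K1 :|: K2).
Proof.
move=> /cliqueP K1P /cliqueP K2P K12; apply/cliqueP => x y.
case/setUP=> [x1|x2] /setUP[y1|y2] xy; [exact: K1P | exact: K12 | | exact: K2P].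
by rewrite edge_sym K12.
Qed.

Lemma clique2 x y : edge x y -> clique [set x; y].
Proof.
by move=> xy; apply: cliqueU => [||u v /set1P-> /set1P->] //; apply: clique1.
Qed.

Lemma clique_number_geq K : clique K -> #|K| <= clique_number G.
Proof. exact: leq_bigmax_cond. Qed.

Lemma exists_maximum_clique :
  exists2 K : {set G}, clique K & #|K| = clique_number G.
Proof.
have clique0 : clique (set0 : {set G}) by apply/cliqueP => x; rewrite inE.
have : 0 < #|@clique G| by apply/card_gt0P; exists set0.
by case/(eq_bigmax_cond (fun K => #|K|)) => K clK eqK; exists K.
Qed.

End Cliques.

Section Colorings.
Variable G : sgraph.
Implicit Types (S : {set G}) (k : nat).

Definition independent S := {in S &, forall x y, ~~ edge x y}.

Definition proper_on S (c : G -> nat) :=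
  {in S &, forall x y, edge x y -> c x != c y}.

Definition colorable_on S k :=
  exists2 c : G -> nat, proper_on S c & {in S, forall x, c x < k}.

Lemma chromatic_number_leq k :
  colorable_on [set: G] k -> chromatic_number G <= k.
Proof.
case=> c c_proper c_lt; rewrite /chromatic_number; case: ex_minnP => m _; apply.
have c_ltT x : c x < k by rewrite c_lt.
apply/existsP; exists [ffun x => Ordinal (c_ltT x)].
apply/forallP => x; apply/forallP => y; apply/implyP => xy; rewrite !ffunE.
by rewrite -val_eqE /= c_proper.
Qed.

Lemma colorable_on_cover (T : finType) (D : {set T}) (C : T -> {set G}) S :
  {in D, forall i, independent (C i)} -> S \subset \bigcup_(i in D) C i ->
  colorable_on S #|D|.
Proof.
move=> C_indep /subsetP SC.
pose c x := find (fun i => x \in C i) (enum D).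
have has_c x : x \in S -> has (fun i => x \in C i) (enum D).
  by move/SC/bigcupP=> [i Di xi]; apply/hasP; exists i; rewrite ?mem_enum.
exists c => [x y Sx Sy xy | x Sx]; last by rewrite cardE -has_find has_c.
have /hasP[i0 _ _] := has_c x Sx.
apply: contraL xy => /eqP cxy; apply: (C_indep (nth i0 (enum D) (c x))).
- by rewrite -mem_enum mem_nth // -has_find has_c.
- exact: nth_find (has_c x Sx).
- by rewrite cxy; apply: nth_find (has_c y Sy).
Qed.

Lemma colorable_onS S1 S2 k :
  S1 \subset S2 -> colorable_on S2 k -> colorable_on S1 k.
Proof.
move=> /subsetP sS [c c_proper c_lt]; exists c; first exact: sub_in2 c_proper.
exact: sub_in1 c_lt.
Qed.

Lemma colorable_onU S1 S2 k1 k2 :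
  colorable_on S1 k1 -> colorable_on S2 k2 ->
  colorable_on (S1 :|: S2) (k1 + k2).
Proof.
move=> [c1 c1P c1_lt] [c2 c2P c2_lt].
exists (fun x => if x \in S1 then c1 x else k1 + c2 x) => [x y | x];
  rewrite !inE.
  case: ifPn => [x1 _ | _ /= x2]; case: ifPn => [y1 _ | _ /= y2] xy.
  - exact: c1P.
  - by have := c1_lt _ x1; lia.
  - by have := c1_lt _ y1; lia.
  - by rewrite eqn_add2l c2P.
case: ifPn => [/c1_lt x1 _ | _ /c2_lt x2]; first exact: ltn_addr.
by rewrite ltn_add2l.
Qed.

End Colorings.

Section GreedyColorings.
Variable G : sgraph.
Implicit Type S : {set G}.

Definition greedy_on S (c : G -> nat) := proper_on S c /\
  {in S, forall x i, i < c x -> exists y, [/\ y \in S, edge x y & c y = i]}.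

Lemma proper_on_recolor S (c : G -> nat) x i :
  proper_on S c -> {in S, forall y, edge x y -> c y != i} ->
  proper_on S (fun y => if y == x then i else c y).
Proof.
move=> c_proper no_i y z Sy Sz.
case: (eqVneq y x) => [->|_]; case: (eqVneq z x) => [->|_] yz.
- by rewrite edge_irrefl in yz.
- by rewrite eq_sym no_i.
- by rewrite no_i // edge_sym.
- exact: c_proper.
Qed.

(* A proper colouring whose sum of colours is minimal is greedy. *)
Lemma exists_greedy_coloring S : exists c, greedy_on S c.
Proof.
pose coloring := {ffun G -> 'I_#|G|}.
pose proper (c : coloring) :=
  [forall x in S, forall y in S, edge x y ==> (c x != c y)].
have properP (c : coloring) :
    reflect (proper_on S (fun x => val (c x))) (proper c).
  apply: (iffP forall_inP) => cP x; last first.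
    by move=> Sx; apply/forall_inP => y Sy; apply/implyP; apply: cP.
  by move=> y Sx Sy; apply/implyP/(forall_inP (cP x Sx)).
have proper_rank : proper [ffun x => enum_rank x].
  apply/properP => x y _ _; rewrite !ffunE; apply: contraTneq.
  by move/val_inj/enum_rank_inj->; rewrite edge_irrefl.
case: (arg_minnP (fun c : coloring => \sum_x val (c x)) proper_rank).
move=> c /properP c_proper c_min.
exists (fun x => val (c x)); split=> // x Sx i i_lt.
case: (boolP [exists y in S, edge x y && (c y == i :> nat)]).
  by case/exists_inP=> y Sy /andP[xy /eqP cy]; exists y.
rewrite negb_exists_in => /forall_inP no_nbr.
pose i_ord := Ordinal (ltn_trans i_lt (ltn_ord (c x))).
pose c' := [ffun y => if y == x then i_ord else c y].
have no_i : {in S, forall y, edge x y -> val (c y) != i}.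
  by move=> y /no_nbr + xy; rewrite xy.
have /c_min : proper c'.
  apply/properP => y z Sy Sz yz; rewrite !ffunE !(fun_if val).
  exact: proper_on_recolor c_proper no_i _ _ Sy Sz yz.
rewrite (bigD1 x) // [leqRHS](bigD1 x) //= ffunE eqxx.
have -> : \sum_(y | y != x) val (c' y) = \sum_(y | y != x) val (c y).
  by apply: eq_bigr => y /negPf yx; rewrite ffunE yx.
by rewrite leq_add2r leqNgt i_lt.
Qed.

(* Take [v] in [C] with the most neighbours in [Q]. If [v] misses [u] in [Q],
   let [w] in [C] be adjacent to [u]; by maximality some [z] in [Q] is adjacent
   to [v] but not to [w], and [v z u w] is an induced P4. *)
Lemma P4_free_complete_vertex (S C Q : {set G}) :
  free_on (path_graph 4) S -> C \subset S -> Q \subset S ->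
  independent C -> C != set0 -> clique Q ->
  {in Q, forall u, exists2 w, w \in C & edge u w} ->
  exists2 v, v \in C & Q \subset neighbours v.
Proof.
move=> SP4 /subsetP CS /subsetP QS C_indep /set0Pn[v0 Cv0] /cliqueP Q_clique.
move=> C_nbr.
have [v Cv v_max] := arg_maxnP (fun v => #|Q :&: neighbours v|) Cv0.
exists v => //; apply/subsetP => u Qu; rewrite inE; apply/contraT => vu.
have [w Cw uw] := C_nbr u Qu.
have /subsetPn[z] : ~~ (Q :&: neighbours v \subset Q :&: neighbours w).
  apply: contraL (v_max w Cw) => sub_vw; rewrite -ltnNge proper_card //.
  apply/properP; split=> //; exists u; first by rewrite !inE Qu edge_sym.
  by rewrite !inE (negPf vu) andbF.
rewrite !inE => /andP[Qz vz]; rewrite Qz /= => wz.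
have zu : edge z u by apply: Q_clique => //; apply: contraNneq vu => <-.
have : [|| edge v u, edge z w | edge v w].
  apply: (P4_free_chord SP4) => // t; rewrite !inE.
  by case/or4P=> /eqP->; [exact: CS | exact: QS | exact: QS | exact: CS].
by rewrite (negPf vu) edge_sym (negPf wz) (negPf (C_indep _ _ Cv Cw)).
Qed.

Lemma P4_free_greedy_clique S (c : G -> nat) x :
  free_on (path_graph 4) S -> greedy_on S c -> x \in S ->
  exists2 Q : {set G}, clique Q & Q \subset S /\ #|Q| = (c x).+1.
Proof.
move=> SP4 [c_proper c_greedy] Sx.
suff grow j : j <= c x -> exists2 Q : {set G}, clique Q &
    [/\ Q \subset S, #|Q| = j.+1 & {in Q, forall q, c x - j <= c q}].
  by have [Q Q_clique [QS Qcard _]] := grow (c x) (leqnn _); exists Q.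
elim: j => [_|j IHj j_lt].
  exists [set x]; first exact: clique1.
  by rewrite sub1set cards1 subn0; split=> // q /set1P->.
have [Q Q_clique [QS Qcard Qc]] := IHj (ltnW j_lt).
pose i := c x - j.+1; pose C := [set v in S | c v == i].
have Qi q : q \in Q -> i < c q by move/Qc; rewrite /i; lia.
have C_nbr q : q \in Q -> exists2 y, y \in C & edge q y.
  move=> Qq; have [y [Sy qy cy]] := c_greedy q (subsetP QS q Qq) i (Qi q Qq).
  by exists y; rewrite // inE Sy cy /=.
have C_indep : independent C.
  move=> u v /setIdP[Su /eqP cu] /setIdP[Sv /eqP cv].
  by apply: contraTN (eqxx i) => /(c_proper _ _ Su Sv); rewrite cu cv.
have CS : C \subset S by apply/subsetP => v /setIdP[].
have /card_gt0P[q /C_nbr[y Cy _]] : 0 < #|Q| by rewrite Qcard.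
have C_neq0 : C != set0 by apply/set0Pn; exists y.
have [v /setIdP[Sv /eqP cv] /subsetP vQ] :=
  P4_free_complete_vertex SP4 CS QS C_indep C_neq0 Q_clique C_nbr.
exists (v |: Q).
  by apply: cliqueU => // [|u w /set1P-> /vQ]; [exact: clique1 | rewrite inE].
have vNQ : v \notin Q by apply/negP => /Qi; rewrite cv ltnn.
rewrite subUset sub1set Sv QS cardsU1 vNQ Qcard; split=> // u.
by case/setU1P=> [->|/Qi/ltnW//]; rewrite cv.
Qed.

Lemma P4_free_colorable_on S (k : nat) :
  free_on (path_graph 4) S ->
  (forall Q : {set G}, Q \subset S -> clique Q -> #|Q| <= k) ->
  colorable_on S k.
Proof.
move=> SP4 Q_le; have [c c_greedy] := exists_greedy_coloring S.
exists c => [|x Sx]; first by case: c_greedy.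
have [Q Q_clique [QS <-]] := P4_free_greedy_clique SP4 c_greedy Sx.
exact: Q_le.
Qed.

End GreedyColorings.

Lemma butterfly_free_independent (G : sgraph) (o : G) (P : {set G}) :
  free_of butterfly G -> clique (o |: P) -> 1 < #|P| ->
  independent [set v in neighbours o | [disjoint P & neighbours v]].
Proof.
move=> bf /cliqueP oP_clique /card_gt1P[i [j [Pi Pj ij]]] v w.
rewrite !inE => /andP[ov /disjoint_setI0/setP Pv].
move=> /andP[ow /disjoint_setI0/setP Pw].
have nbrP u : u \in P -> [/\ edge o u, ~~ edge v u & ~~ edge w u].
  move=> Pu; have := Pv u; have := Pw u.
  rewrite !inE Pu /= => -> vu; split=> //.
    apply: oP_clique; rewrite ?setU11 ?setU1r //.
    by apply: contraFneq vu => <-; rewrite edge_sym.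
  by rewrite vu.
have [oi /negPf vi /negPf wi] := nbrP i Pi.
have [oj /negPf vj /negPf wj] := nbrP j Pj.
apply/negP => vw.
have : [|| edge v i, edge v j, edge w i | edge w j].
  apply: (@butterfly_free_neighbours _ o) => // [u|].
    by rewrite !inE => /or4P[]/eqP->.
  by apply: oP_clique; rewrite ?setU1r.
by rewrite vi vj wi wj.
Qed.

Section MaximumClique.
Variables (G : sgraph) (A : {set G}).
Hypotheses (A_clique : clique A) (A_max : #|A| = clique_number G).

Definition non_neighbours (v : G) := A :\: neighbours v.

Lemma clique_leq_non_neighbours (K : {set G}) :
  clique K -> #|K| <= #|\bigcup_(v in K) non_neighbours v|.
Proof.
move=> K_clique; set N := \bigcup_(v in K) _.
have KA x y : x \in K -> y \in A :\: N -> edge x y.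
  move=> Kx /setDP[Ay]; apply: contraNT => xy.
  by apply/bigcupP; exists x; rewrite // !inE Ay xy.
have disjKA : [disjoint K & A :\: N].
  rewrite disjoint_subset; apply/subsetP => x Kx; apply/negP => /(KA x x Kx).
  by rewrite edge_irrefl.
have : #|K :|: (A :\: N)| <= #|A|.
  rewrite A_max clique_number_geq // cliqueU //.
  exact: cliqueS (subsetDl _ _) A_clique.
have := cardsID N A; have := subset_leq_card (subsetIr A N).
by rewrite cardsU (disjoint_setI0 disjKA) cards0; lia.
Qed.

Lemma non_neighbours_gt0 v : 0 < #|non_neighbours v|.
Proof.
by have := clique_leq_non_neighbours (clique1 v); rewrite cards1 big_set1.
Qed.

Lemma edge_non_neighbours v w :
  edge v w -> 1 < #|non_neighbours v :|: non_neighbours w|.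
Proof.
move=> vw; have vw_neq : v != w.
  by apply: contraTneq vw => ->; rewrite edge_irrefl.
have := clique_leq_non_neighbours (clique2 vw).
by rewrite cards2 vw_neq big_setU1 ?inE // big_set1.
Qed.

Lemma colorable_on_one_non_neighbour :
  colorable_on [set v | #|non_neighbours v| <= 1] #|A|.
Proof.
pose only i := [set v | non_neighbours v == [set i]].
apply: (@colorable_on_cover _ _ A only).
  move=> i _ v w; rewrite !inE => /eqP vi /eqP wi.
  by apply/negP => /edge_non_neighbours; rewrite vi wi setUid cards1.
apply/subsetP => v; rewrite inE => v_le1.
have /cards1P[i vi] : #|non_neighbours v| == 1.
  by rewrite eqn_leq v_le1 non_neighbours_gt0.
apply/bigcupP; exists i; last by rewrite inE vi.
by have := set11 i; rewrite -vi => /setDP[].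
Qed.

Variables a b : G.
Hypotheses (Aa : a \in A) (Ab : b \in A) (neq_ab : a != b).
Hypothesis G_butterfly_free : free_of butterfly G.

Definition apex (P : {set G}) := if a \in P then b else a.

Lemma exists_non_neighbours_pair v :
  1 < #|non_neighbours v| -> v \in neighbours a :|: neighbours b ->
  exists P : {set G},
    [/\ P \subset non_neighbours v, #|P| = 2 & edge (apex P) v].
Proof.
rewrite /apex !inE => v_gt1 vab; case: (boolP (a \in non_neighbours v)) => va.
  have : 0 < #|non_neighbours v :\ a| by move: v_gt1; rewrite (cardsD1 a) va.
  case/card_gt0P=> j /setD1P[ja vj]; exists [set a; j].
  rewrite subUset !sub1set va vj cards2 eq_sym ja set21; split=> //.
  by move: vab va; rewrite !inE Aa andbT (edge_sym v a) => /orP[->|].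
case/card_gt1P: v_gt1 => i [j [vi vj ij]]; exists [set i; j].
have aP : a \notin [set i; j] by apply: contra va => /set2P[]->.
rewrite subUset !sub1set vi vj cards2 ij (negPf aP); split=> //.
by move: va; rewrite !inE Aa andbT negbK edge_sym.
Qed.

Lemma colorable_on_two_non_neighbours :
  colorable_on
    [set v in neighbours a :|: neighbours b | 1 < #|non_neighbours v|]
    'C(#|A|, 2).-1.
Proof.
pose pairs := [set P : {set G} | P \subset A & #|P| == 2].
have <- : #|pairs :\ [set a; b]| = 'C(#|A|, 2).-1.
  rewrite -cards_draws -/pairs (cardsD1 [set a; b] pairs) inE cards2 neq_ab.
  by rewrite subUset !sub1set Aa Ab.
apply: (@colorable_on_cover _ _ _ (fun P =>
  [set v in neighbours (apex P) | [disjoint P & neighbours v]])).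
  move=> P /setD1P[_ /setIdP[PA /eqP P2]].
  apply: butterfly_free_independent; rewrite ?P2 //.
  apply: cliqueS A_clique; rewrite subUset sub1set PA andbT /apex.
  by case: ifP.
apply/subsetP => v /setIdP[vab v_gt1].
have [P [+ P2 vP]] := exists_non_neighbours_pair v_gt1 vab.
rewrite subsetD => /andP[PA Pv].
apply/bigcupP; exists P; last by rewrite !inE vP.
rewrite !inE PA P2 eqxx !andbT; apply: contraTneq vP => Pab.
rewrite /apex Pab set21; have := disjointFr Pv (x := b).
by rewrite Pab set22 inE edge_sym => ->.
Qed.

Hypothesis G_P2UP4_free :
  free_of (disjoint_union (path_graph 2) (path_graph 4)) G.

Lemma chromatic_number_leq_bin :
  chromatic_number G <= #|A| + 'C(#|A|, 2).-1 + #|A|.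
Proof.
have ab : edge a b by apply/(cliqueP _ A_clique).
have colorable_far : colorable_on (~: (neighbours a :|: neighbours b)) #|A|.
  apply: P4_free_colorable_on => [|Q _ Q_clique].
    exact: P2UP4_free_anticomplete.
  by rewrite A_max clique_number_geq.
apply: chromatic_number_leq.
apply: colorable_onS _ (colorable_onU (colorable_onU
  colorable_on_one_non_neighbour colorable_on_two_non_neighbours)
  colorable_far).
by apply/subsetP => v _; rewrite !inE; case: leqP; rewrite // andbT orbN.
Qed.

End MaximumClique.

Lemma chromatic_number_bound (G : sgraph) : 0 < #|G| ->
  free_of (disjoint_union (path_graph 2) (path_graph 4)) G ->
  free_of butterfly G ->
  chromatic_number G < 2 * clique_number G + 'C(clique_number G, 2).
Proof.
move=> /card_gt0P[x _] P2UP4_free butterfly_free.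
have [A A_clique A_max] := exists_maximum_clique G; rewrite -A_max.
have [A_le1 | /[dup] A_gt1 /card_gt1P[a [b [Aa Ab ab]]]] := leqP #|A| 1.
  have A_gt0 : 0 < #|A|.
    have := non_neighbours_gt0 A_clique A_max x.
    by move/leq_trans; apply; apply/subset_leq_card/subsetDl.
  suff : chromatic_number G <= #|A| by lia.
  apply: chromatic_number_leq.
  apply: colorable_onS _ (colorable_on_one_non_neighbour A_clique A_max).
  apply/subsetP => v _; rewrite inE.
  exact: leq_trans (subset_leq_card (subsetDl _ _)) A_le1.
have : 0 < 'C(#|A|, 2) by rewrite bin_gt0.
have := chromatic_number_leq_bin A_clique A_max Aa Ab ab butterfly_free.
by move=> /(_ P2UP4_free); lia.
Qed.

Local Open Scope ring_scope.

Theorem theorem1p2 (G : sgraph) (G_nonempty : (0 < #|G|)%N)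
    (G_P2UP4_free : free_of (disjoint_union (path_graph 2) (path_graph 4)) G)
    (G_butterfly_free : free_of butterfly G) :
  (chromatic_number G)%:R
    <= ((clique_number G)%:R ^+ 2 + 3 * (clique_number G)%:R - 2) / 2 :> rat.
Proof.
have chi_lt := chromatic_number_bound G_nonempty G_P2UP4_free G_butterfly_free.
rewrite ler_pdivlMr // lerBrDr mulrC -natrX -!natrM -!natrD ler_nat.
move: chi_lt (mul_bin_left (clique_number G) 1); rewrite bin1.
move: (clique_number G) 'C(_, _) => w B; nia.
Qed.
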